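(* Let $\mathbf I_k=(2k\pi,2\pi+2k\pi)$, $k\in\mathbb Z$. Each non-trivial orbit $\Omega_F\subset\mathfrak g_{4,4,1}^*$, $F=\alpha X^*+\beta Y^*+\gamma Z^*+\delta T^*$, of the co-adjoint representation of $G_{4,4,1}$ admits local charts $(\mathbb R\times\mathbf I_k,\psi_k^{-1})$ or $(\mathbb R_\pm\times\mathbf I_k,\psi_k^{-1})$, with coordinates $(p,q)$, such that: (1) If $\gamma=0$ and $\alpha^2+\beta^2\neq0$, so that $\Omega_F=\{(\alpha\cos\theta-\beta\sin\theta,\ \alpha\sin\theta+\beta\cos\theta,\ 0,\ t)\mid\theta,t\in\mathbb R\}$, then for $A=aX+bY+cZ+dT\in\mathfrak g_{4,4,1}$ $$\widetilde A\circ\psi_k(p,q)=dp+\tfrac12[a(\alpha+i\beta)+b(\beta-i\alpha)]e^{iq}+\tfrac12[a(\alpha-i\beta)+b(\beta+i\alpha)]e^{-iq}=dp+(a\alpha+b\beta)\cos q+(b\alpha-a\beta)\sin q,$$ and the Kirillov form is $\omega=dp\wedge dq$. (2) If $\gamma\neq0$, so that $\Omega_F=\{(x,y,\gamma,t)\mid x^2+y^2-2\gamma t=\alpha^2+\beta^2-2\gamma\delta;\ x,y,t\in\mathbb R\}$, then for $A=aX+bY+cZ+dT\in\mathfrak g_{4,4,1}$ $$\widetilde A\circ\psi_k(p,q)=\frac{d}{2\gamma}p^2+\left[\frac a2(e^{iq}+e^{-iq})+\frac b{2i}(e^{iq}-e^{-iq})\right]p+c\gamma+d\delta-d\,\frac{\alpha^2+\beta^2}{2\gamma}$$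 $$=\frac d{2\gamma}p^2+(a\cos q+b\sin q)p+c\gamma+d\delta-d\,\frac{\alpha^2+\beta^2}{2\gamma},$$ and the Kirillov form is $\omega=\frac{\gamma}{p}\,dp\wedge dq$.
   Context: $G_{4,4,1}=\mathbb R\ltimes_j\mathbb H_3$ is the connected and simply connected Lie group whose Lie algebra $\mathfrak g_{4,4,1}$ has basis $X,Y,Z,T$ with nonzero brackets $[T,X]=-Y$, $[T,Y]=X$, $[X,Y]=Z$ (and those obtained by antisymmetry). $X^*,Y^*,Z^*,T^*$ is the dual basis and $(\alpha,\beta,\gamma,\delta)$ denotes $\alpha X^*+\beta Y^*+\gamma Z^*+\delta T^*$. The co-adjoint action $K$ of $G$ on $\mathfrak g^*$ is $\langle K(g)F,X\rangle=\langle F,\mathrm{Ad}(g^{-1})X\rangle$; $\Omega_F$ is the orbit of $F$, non-trivial if it is not a single point (equivalently $(\alpha,\beta,\gamma)\neq0$). For $A\in\mathfrak g$, $\widetilde A(F')=\langle F',A\rangle$ for $F'\in\Omega_F$, and $\xi_A$ is the vector field on $\Omega_F$ given by $(\xi_Af)(x)=\frac d{dt}f(x\exp(tA))|_{t=0}$, where $x\exp(tA)=K(\exp(-tA))x$. The Kirillov form $\omega$ on $\Omega_F$ is determined by $\omega_{F'}(\xi_A,\xi_B)=\langle F',[A,B]\rangle$, $A,B\in\mathfrak g$. $\mathbb R_+$ and $\mathbb R_-$ are the sets of positive and negative reals; $\psi_k$ maps the coordinate domain into $\Omega_F$.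
   Formalization: In part (2) the Kirillov form is stated as ω = (p/γ) dp∧dq instead of the printed (γ/p) dp∧dq, which contradicts ω(ξ_X,ξ_Y) = ⟨F',[X,Y]⟩ = γ, since dp∧dq(ξ_X,ξ_Y) = γ²/p. *)

(* Defs.v *)
From HB Require Import structures.
From mathcomp Require Import all_boot all_order all_algebra.
From mathcomp Require Import all_classical all_reals all_analysis.
From mathcomp Require Import complex.
Set Implicit Arguments.
Unset Strict Implicit.
Unset Printing Implicit Defensive.
Import Order.TTheory GRing.Theory Num.Theory numFieldNormedType.Exports.
Local Open Scope classical_set_scope.
Local Open Scope ring_scope.

(* Elements of the group, of its Lie algebra g and of the dual g^* are all
   vectors of R^4: a X + b Y + c Z + d T is [vec4 a b c d], and
   alpha X^* + beta Y^* + gamma Z^* + delta T^* is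
   [vec4 alpha beta gamma delta].                                            *)
Definition vec4 (R : realType) (x y z t : R) : 'rV[R]_4 :=
  \row_(i < 4) [:: x; y; z; t]`_i.

Definition coX (R : realType) (v : 'rV[R]_4) : R := v 0 (@Ordinal 4 0 isT).
Definition coY (R : realType) (v : 'rV[R]_4) : R := v 0 (@Ordinal 4 1 isT).
Definition coZ (R : realType) (v : 'rV[R]_4) : R := v 0 (@Ordinal 4 2 isT).
Definition coT (R : realType) (v : 'rV[R]_4) : R := v 0 (@Ordinal 4 3 isT).

(* The bilinear antisymmetric extension of
   [T, X] = - Y, [T, Y] = X, [X, Y] = Z.                                     *)
Definition lie_bracket (R : realType) (A B : 'rV[R]_4) : 'rV[R]_4 :=
  vec4 (coT A * coY B - coY A * coT B)
       (coX A * coT B - coT A * coX B)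
       (coX A * coY B - coY A * coX B)
       0.

(* The simply connected group R |x_j H_3 on R^4.  The vector (x, y, z, t)
   stands for h exp(t T), where h = exp(x X + y Y + z Z) in H_3.  The product
   of H_3 is (x, y, z)(x', y', z') =
   (x + x', y + y', z + z' + (x y' - y x') / 2), and exp(t T) acts on H_3 by
   the automorphism j(t) = exp(t ad T), the rotation X |-> cos t X - sin t Y,
   Y |-> sin t X + cos t Y, Z |-> Z; whence
   (h, t) (h', t') = (h * j(t) h', t + t').  The neutral element is 0.       *)
Definition gmul (R : realType) (g h : 'rV[R]_4) : 'rV[R]_4 :=
  let x' := cos (coT g) * coX h + sin (coT g) * coY h in
  let y' := cos (coT g) * coY h - sin (coT g) * coX h in
  vec4 (coX g + x') (coY g + y')
       (coZ g + coZ h + (coX g * y' - coY g * x') / 2)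
       (coT g + coT h).

Definition ginv (R : realType) (g : 'rV[R]_4) : 'rV[R]_4 :=
  vec4 (- (cos (coT g) * coX g - sin (coT g) * coY g))
       (- (cos (coT g) * coY g + sin (coT g) * coX g))
       (- coZ g)
       (- coT g).

(* c is the one-parameter subgroup with velocity A at the neutral element.   *)
Definition one_param_subgroup (R : realType) (A : 'rV[R]_4)
    (c : R -> 'rV[R]_4) : Prop :=
  (forall s t, c (s + t) = gmul (c s) (c t)) /\ is_derive (0 : R) 1 c A.

Definition gexp (R : realType) (A : 'rV[R]_4) : 'rV[R]_4 :=
  xget 0 [set g | exists2 c, one_param_subgroup A c & g = c 1].

(* Differential at the neutral element of h |-> g h g^-1.                    *)
Definition Ad (R : realType) (g A : 'rV[R]_4) : 'rV[R]_4 :=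
  'd (fun h : 'rV[R]_4 => gmul (gmul g h) (ginv g)) (0 : 'rV[R]_4) A.

(* The pairing < F, A >; for fixed A it is the function written A with a
   tilde on the orbits.                                                      *)
Definition pairing (R : realType) (F A : 'rV[R]_4) : R :=
  \sum_(i < 4) F 0 i * A 0 i.

(* The element K(g) F of g^* such that < K(g) F, A > = < F, Ad(g^-1) A >.    *)
Definition coadjoint (R : realType) (g F : 'rV[R]_4) : 'rV[R]_4 :=
  \row_(i < 4) pairing F (Ad (ginv g) (delta_mx 0 i)).

Definition coadjoint_orbit (R : realType) (F : 'rV[R]_4) : set 'rV[R]_4 :=
  [set coadjoint g F | g in [set: 'rV[R]_4]].

Definition nontrivial_orbit (R : realType) (F : 'rV[R]_4) : Prop :=
  ~ exists x, coadjoint_orbit F = [set x].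

(* The value at x of the vector field xi_A, seen as a vector of g^*: the
   velocity at t = 0 of the curve x exp(t A) = K(exp(- t A)) x.              *)
Definition xi (R : realType) (A x : 'rV[R]_4) : 'rV[R]_4 :=
  'D_1 (fun t : R => coadjoint (gexp (- (t *: A))) x) (0 : R).

(* The Kirillov form at F', on vectors u, v tangent at F' to the orbit, i.e.
   of the form xi_A(F'), xi_B(F'); it has the junk value 0 on the other
   vectors.                                                                  *)
Definition kirillov_form (R : realType) (F' u v : 'rV[R]_4) : R :=
  xget 0 [set r | exists A B : 'rV[R]_4,
    [/\ xi A F' = u, xi B F' = v & r = pairing F' (lie_bracket A B)]].

(* f is of class C^n on the open set U of a finite-dimensional space.        *)
Fixpoint Cn_on (R : realType) (V W : normedModType R) (n : nat) (U : set V)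
    (f : V -> W) : Prop :=
  match n with
  | 0%N => forall x, U x -> {for x, continuous f}
  | m.+1 => (forall x, U x -> differentiable f x) /\
            (forall v : V, Cn_on m U (fun x => 'D_v f x))
  end.

Definition smooth_on (R : realType) (V W : normedModType R) (U : set V)
    (f : V -> W) : Prop := forall n, Cn_on n U f.

(* (U, psi^-1) is a local chart of the surface Omega of g^*: psi is a smooth
   injective immersion of the open set U of R^2 and a homeomorphism of U onto
   an open subset of Omega, for the topology induced by that of g^*.         *)
Definition local_chart (R : realType) (Omega : set 'rV[R]_4)
    (U : set (R * R)) (psi : R * R -> 'rV[R]_4) : Prop :=
  [/\ open U,
      smooth_on U psi,
      (forall m, U m -> injective ('d psi m)),
      set_inj U psi &
      forall O : set (R * R), open O -> O `<=` U ->
        exists2 V : set 'rV[R]_4, open V & psi @` O = Omega `&` V].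

(* In the chart psi, the Kirillov form is f(p, q) dp /\ dq.                  *)
Definition kirillov_in_chart (R : realType) (U : set (R * R))
    (psi : R * R -> 'rV[R]_4) (f : R -> R -> R) : Prop :=
  forall p q, U (p, q) -> forall u v : R * R,
    kirillov_form (psi (p, q)) ('d psi (p, q) u) ('d psi (p, q) v) =
    f p q * (u.1 * v.2 - u.2 * v.1).

Definition Iint (R : realType) (k : int) : set R :=
  [set q | 2 * k%:~R * pi < q < 2 * pi + 2 * k%:~R * pi].

(* R_+ for s = true, R_- for s = false. *)
Definition half_line (R : realType) (s : bool) : set R :=
  if s then [set p | 0 < p] else [set p | p < 0].

(* The complex number e^{i q}. *)
Definition expi (R : realType) (q : R) : R[i] := (cos q +i* sin q)%C.

(* Main.v *)
Require Import Defs.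
From HB Require Import structures.
From mathcomp Require Import all_boot all_order all_algebra.
From mathcomp Require Import all_classical all_reals all_analysis.
From mathcomp Require Import complex.
From mathcomp Require Import ring lra.
Set Implicit Arguments.
Unset Strict Implicit.
Unset Printing Implicit Defensive.
Import Order.TTheory GRing.Theory Num.Theory numFieldNormedType.Exports.
Local Open Scope classical_set_scope.
Local Open Scope ring_scope.

(** Everything reduces to explicit formulas in coordinates.

    Differentiating h |-> g h g^-1 at the neutral element gives Ad ([AdE]),
    hence the coadjoint action ([coadjointE]) as a polynomial in the Heisenberg
    coordinates of g^-1, twisted by the rotation of angle its last coordinate.
    As g runs over the group, this sweeps out a cylinder over a circle when
    gamma = 0 ([cylinder_orbit]) and a paraboloid of revolution when gamma <> 0
    ([paraboloid_orbit]); both are surfaces of revolution around the T^* direction,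
    the rotations being the flow of xi_T.

    The exponential is characterised as the time-one value of a one-parameter
    subgroup.  Such a curve c solves c' = (left translation by c) A, a
    triangular system that can be integrated coordinate by coordinate
    ([one_param_unique]), and an explicit solution exists ([one_paramP]).  Thus
    exp(s A) is known, and xi_A(F) is the linear form <F, [A, .]> ([xiE]).
    Consequently <F, [A, B]> = <xi_A(F), B> depends on A, and by antisymmetry
    on B, only through the tangent vectors, so the Kirillov form is well defined
    ([kirillov_formE]), and it is computed in a chart as soon as the coordinate
    velocities are exhibited as values of fields xi_A ([kirillov_chart]).

    Both charts are polar: q is the angle around the axis and p is the height
    on the cylinder, the signed radius on the paraboloid.  Their components are
    polynomials in p, cos q and sin q, a class stable under directional
    derivatives, hence smooth ([trig_poly_smooth]).  That they are homeomorphisms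
    onto open subsets of the orbit follows from a continuous left inverse, in
    which the angle of a unit vector (c, s) other than (1, 0) is written with a
    half-angle arctangent ([trig_angle], [polar_chart]). *)

(** * Coordinates on R^4 *)

Lemma coX_vec4 (R : realType) (x y z t : R) : coX (vec4 x y z t) = x.
Proof. by rewrite /coX mxE. Qed.

Lemma coY_vec4 (R : realType) (x y z t : R) : coY (vec4 x y z t) = y.
Proof. by rewrite /coY mxE. Qed.

Lemma coZ_vec4 (R : realType) (x y z t : R) : coZ (vec4 x y z t) = z.
Proof. by rewrite /coZ mxE. Qed.

Lemma coT_vec4 (R : realType) (x y z t : R) : coT (vec4 x y z t) = t.
Proof. by rewrite /coT mxE. Qed.

Definition co_vec4 := (coX_vec4, coY_vec4, coZ_vec4, coT_vec4).

Lemma vec4_co (R : realType) (v : 'rV[R]_4) :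
  v = vec4 (coX v) (coY v) (coZ v) (coT v).
Proof.
apply/rowP => -[[|[|[|[|//]]]] i4]; rewrite mxE /=;
  by congr (v _ _); apply: val_inj.
Qed.

Lemma vec4_inj (R : realType) (x y z t x' y' z' t' : R) :
  vec4 x y z t = vec4 x' y' z' t' -> [/\ x = x', y = y', z = z' & t = t'].
Proof.
move=> e; split.
- by rewrite -(coX_vec4 x y z t) e coX_vec4.
- by rewrite -(coY_vec4 x y z t) e coY_vec4.
- by rewrite -(coZ_vec4 x y z t) e coZ_vec4.
- by rewrite -(coT_vec4 x y z t) e coT_vec4.
Qed.

Lemma co0 (R : realType) :
  [/\ coX (0 : 'rV[R]_4) = 0, coY (0 : 'rV[R]_4) = 0,
      coZ (0 : 'rV[R]_4) = 0 & coT (0 : 'rV[R]_4) = 0].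
Proof. by rewrite /coX /coY /coZ /coT !mxE. Qed.

Lemma vec40 (R : realType) : vec4 0 0 0 0 = 0 :> 'rV[R]_4.
Proof. by case: (co0 R) => x y z t; rewrite [RHS]vec4_co x y z t. Qed.

Lemma vec4_linear (R : realType) (k x y z t x' y' z' t' : R) :
  k *: vec4 x y z t + vec4 x' y' z' t' =
  vec4 (k * x + x') (k * y + y') (k * z + z') (k * t + t').
Proof. by apply/rowP => -[[|[|[|[|//]]]] i4]; rewrite !mxE. Qed.

Lemma vec4D (R : realType) (x y z t x' y' z' t' : R) :
  vec4 x y z t + vec4 x' y' z' t' = vec4 (x + x') (y + y') (z + z') (t + t').
Proof. by rewrite -[vec4 x y z t]scale1r vec4_linear !mul1r. Qed.

Lemma vec4Z (R : realType) (k x y z t : R) :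
  k *: vec4 x y z t = vec4 (k * x) (k * y) (k * z) (k * t).
Proof. by rewrite -[LHS]addr0 -vec40 vec4_linear !addr0. Qed.

Lemma pairing_vec4 (R : realType) (x y z t a b c d : R) :
  pairing (vec4 x y z t) (vec4 a b c d) = x * a + y * b + z * c + t * d.
Proof. by rewrite /pairing !big_ord_recr big_ord0 /= !mxE /= add0r. Qed.

Lemma delta_vec4 (R : realType) :
  [/\ delta_mx 0 (@Ordinal 4 0 isT) = vec4 1 0 0 0 :> 'rV[R]_4,
      delta_mx 0 (@Ordinal 4 1 isT) = vec4 0 1 0 0 :> 'rV[R]_4,
      delta_mx 0 (@Ordinal 4 2 isT) = vec4 0 0 1 0 :> 'rV[R]_4 &
      delta_mx 0 (@Ordinal 4 3 isT) = vec4 0 0 0 1 :> 'rV[R]_4].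
Proof. by split; apply/rowP => -[[|[|[|[|//]]]] i4]; rewrite !mxE. Qed.

Lemma vec4_basis (R : realType) (x y z t : R) :
  vec4 x y z t = x *: vec4 1 0 0 0 + y *: vec4 0 1 0 0 + z *: vec4 0 0 1 0
                 + t *: vec4 0 0 0 1.
Proof. by rewrite !vec4Z !vec4D; congr vec4; ring. Qed.

(** * Differentials of explicit functions *)

Lemma is_diff_val (R : realType) (V W : normedModType R) (f df : V -> W)
    (x v : V) : is_diff x f df -> 'd f x v = df v.
Proof. by move=> fP; rewrite diff_val. Qed.

(** The rules below restate the pointwise calculus with the function and its
    differential written as abstractions, so that they match goals by
    higher-order patterns and the differential is built by unification. *)
Lemma is_diff_add (R : realType) (V W : normedModType R) (f g df dg : V -> W)
    (x : V) : is_diff x f df -> is_diff x g dg ->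
  is_diff x (fun y => f y + g y) (fun v => df v + dg v).
Proof. exact: is_diffD. Qed.

Lemma is_diff_opp (R : realType) (V W : normedModType R) (f df : V -> W)
    (x : V) : is_diff x f df -> is_diff x (fun y => - f y) (fun v => - df v).
Proof. exact: is_diffN. Qed.

Lemma is_diff_mul (R : realType) (V : normedModType R) (f g df dg : V -> R)
    (x : V) : is_diff x f df -> is_diff x g dg ->
  is_diff x (fun y => f y * g y) (fun v => f x * dg v + g x * df v).
Proof. exact: is_diffM. Qed.

Lemma is_diff_const (R : realType) (V W : normedModType R) (a : W) (x : V) :
  is_diff x (fun=> a) (fun=> 0).
Proof. exact: is_diff_cst. Qed.

Lemma is_diff_scalev (R : realType) (V W : normedModType R) (f df : V -> R)
    (w : W) (x : V) :
  is_diff x f df -> is_diff x (fun y => f y *: w) (fun v => df v *: w).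
Proof.
move=> h; apply: DiffDef; first by apply: differentiableZl; case: h.
by rewrite diffZl ?diff_val//; case: h.
Qed.

Lemma is_diff_real (R : realType) (V : normedModType R) (g : R -> R) (dg : R)
    (f df : V -> R) (x : V) :
  is_derive (f x) 1 g dg -> is_diff x f df ->
  is_diff x (fun y => g (f y)) (fun v => dg * df v).
Proof.
move=> gP fP; have gd : differentiable g (f x).
  by apply/derivable1_diffP; case: gP.
have gD : is_diff (f x) g (fun h => h *: dg).
  by apply: DiffDef => //; rewrite diff1E// derive1E derive_val.
apply: is_diff_eq (is_diff_comp fP gD) _.
by apply/funext => v /=; rewrite -[_ *: _]/(_ * _) mulrC.
Qed.

Lemma is_diff_cos (R : realType) (V : normedModType R) (f df : V -> R) (x : V) :
  is_diff x f df -> is_diff x (fun y => cos (f y)) (fun v => - sin (f x) * df v).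
Proof. exact: is_diff_real. Qed.

Lemma is_diff_sin (R : realType) (V : normedModType R) (f df : V -> R) (x : V) :
  is_diff x f df -> is_diff x (fun y => sin (f y)) (fun v => cos (f x) * df v).
Proof. exact: is_diff_real. Qed.

Lemma is_diff_vec4 (R : realType) (V : normedModType R)
    (f g h k df dg dh dk : V -> R) (x : V) :
  is_diff x f df -> is_diff x g dg -> is_diff x h dh -> is_diff x k dk ->
  is_diff x (fun y => vec4 (f y) (g y) (h y) (k y))
            (fun v => vec4 (df v) (dg v) (dh v) (dk v)).
Proof.
move=> F G H K.
under [X in is_diff _ X _]funext => y do rewrite vec4_basis.
under [X in is_diff _ _ X]funext => y do rewrite vec4_basis.
by do ![apply: is_diff_add | apply: is_diff_scalev].
Qed.

Lemma is_diff_comp_coord (R : realType) (V : normedModType R) (i : 'I_4)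
    (f df : V -> 'rV[R]_4) (x : V) :
  is_diff x f df -> is_diff x (fun y => f y 0 i) (fun v => df v 0 i).
Proof.
pose p (v : 'rV[R]_4) := v 0 i.
have lp : linear p by move=> ? ? ?; rewrite /p !mxE.
pose pl := GRing.isLinear.Build _ _ _ _ p lp.
pose pL : {linear _ -> _} := HB.pack p pl.
move=> fP; have pP : is_diff (f x) p p.
  have cp : continuous pL by exact: coord_continuous.
  apply: DiffDef; first exact: (@linear_differentiable _ _ _ pL).
  exact: (@diff_lin _ _ _ pL).
exact: (is_diff_comp fP pP).
Qed.

Lemma is_derive_diff (R : realType) (W : normedModType R) (f : R -> W)
    (x : R) (w : W) :
  is_derive x 1 f w <-> is_diff x f (fun h => h *: w).
Proof.
split=> [fP|fP].
  have fd : differentiable f x by apply/derivable1_diffP; case: fP.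
  by apply: DiffDef => //; rewrite diff1E// derive1E derive_val.
have fd : differentiable f x by case: fP.
have fdd : derivable f x 1 by apply/derivable1_diffP.
by apply: DeriveDef => //; rewrite deriveE// diff_val scale1r.
Qed.

Lemma is_diff_continuous (R : realType) (V W : normedModType R) (f df : V -> W)
    (x : V) : is_diff x f df -> {for x, continuous f}.
Proof. by case=> fd _; exact: differentiable_continuous. Qed.

Lemma is_diff_coX (R : realType) (V : normedModType R)
    (f df : V -> 'rV[R]_4) (x : V) :
  is_diff x f df -> is_diff x (fun y => coX (f y)) (fun v => coX (df v)).
Proof. exact: is_diff_comp_coord. Qed.

Lemma is_diff_coY (R : realType) (V : normedModType R)
    (f df : V -> 'rV[R]_4) (x : V) :
  is_diff x f df -> is_diff x (fun y => coY (f y)) (fun v => coY (df v)).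
Proof. exact: is_diff_comp_coord. Qed.

Lemma is_diff_coZ (R : realType) (V : normedModType R)
    (f df : V -> 'rV[R]_4) (x : V) :
  is_diff x f df -> is_diff x (fun y => coZ (f y)) (fun v => coZ (df v)).
Proof. exact: is_diff_comp_coord. Qed.

Lemma is_diff_coT (R : realType) (V : normedModType R)
    (f df : V -> 'rV[R]_4) (x : V) :
  is_diff x f df -> is_diff x (fun y => coT (f y)) (fun v => coT (df v)).
Proof. exact: is_diff_comp_coord. Qed.

Lemma is_diff_fst (R : realType) (m : R * R) : is_diff m fst fst.
Proof.
have lf : linear (fst : R * R -> R) by [].
pose fl := GRing.isLinear.Build _ _ _ _ _ lf.
pose fL : {linear _ -> _} := HB.pack (fst : R * R -> R) fl.
have fc : continuous fL by move=> x; exact: cvg_fst.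
by apply: DiffDef; [exact: (@linear_differentiable _ _ _ fL)
                   |exact: (@diff_lin _ _ _ fL)].
Qed.

Lemma is_diff_snd (R : realType) (m : R * R) : is_diff m snd snd.
Proof.
have lf : linear (snd : R * R -> R) by [].
pose fl := GRing.isLinear.Build _ _ _ _ _ lf.
pose fL : {linear _ -> _} := HB.pack (snd : R * R -> R) fl.
have fc : continuous fL by move=> x; exact: cvg_snd.
by apply: DiffDef; [exact: (@linear_differentiable _ _ _ fL)
                   |exact: (@diff_lin _ _ _ fL)].
Qed.

Lemma is_diff_sqr (R : realType) (V : normedModType R) (f df : V -> R) (x : V) :
  is_diff x f df -> is_diff x (fun y => f y ^+ 2) (fun v => 2 * f x * df v).
Proof.
move=> fP; apply: is_diff_eq (is_diff_mul fP fP) _.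
by apply/funext => v; ring.
Qed.

(** Builds the differential of an expression by walking through it.  Type class
    search is bypassed: left to itself it explores the whole remaining
    expression at every step. *)
Ltac differentiate :=
  repeat lazymatch goal with
  | |- is_diff_def _ (fun y => vec4 _ _ _ _) _ =>
      notypeclasses refine (is_diff_vec4 _ _ _ _)
  | |- is_diff_def _ (fun y => cos _) _ => notypeclasses refine (is_diff_cos _)
  | |- is_diff_def _ (fun y => sin _) _ => notypeclasses refine (is_diff_sin _)
  | |- is_diff_def _ (fun y => (_ + _)%R) _ =>
      notypeclasses refine (is_diff_add _ _)
  | |- is_diff_def _ (fun y => (- _)%R) _ =>
      notypeclasses refine (is_diff_opp _)
  | |- is_diff_def _ (fun y => (_ * _)%R) _ =>
      notypeclasses refine (is_diff_mul _ _)
  | |- is_diff_def _ (fun y => (_ ^+ 2)%R) _ =>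
      notypeclasses refine (is_diff_sqr _)
  | |- is_diff_def _ (fun y => fst y) _ => exact: is_diff_fst
  | |- is_diff_def _ (fun y => snd y) _ => exact: is_diff_snd
  | |- is_diff_def _ fst _ => exact: is_diff_fst
  | |- is_diff_def _ snd _ => exact: is_diff_snd
  | |- is_diff_def _ (fun y => coX _) _ => notypeclasses refine (is_diff_coX _)
  | |- is_diff_def _ (fun y => coY _) _ => notypeclasses refine (is_diff_coY _)
  | |- is_diff_def _ (fun y => coZ _) _ => notypeclasses refine (is_diff_coZ _)
  | |- is_diff_def _ (fun y => coT _) _ => notypeclasses refine (is_diff_coT _)
  | |- is_diff_def _ (@coX _) _ => exact: (is_diff_coX (is_diff_id _))
  | |- is_diff_def _ (@coY _) _ => exact: (is_diff_coY (is_diff_id _))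
  | |- is_diff_def _ (@coZ _) _ => exact: (is_diff_coZ (is_diff_id _))
  | |- is_diff_def _ (@coT _) _ => exact: (is_diff_coT (is_diff_id _))
  | |- is_diff_def _ (GRing.mul _) _ =>
      exact: (is_diff_mul (is_diff_const _ _) (is_diff_id _))
  | |- is_diff_def _ (fun y => y) _ => exact: is_diff_id
  | |- _ => notypeclasses refine (is_diff_const _ _)
  end.

(** * The adjoint and coadjoint actions *)

(** The terms in d come from the rotation by t + coT h: differentiating it at
    t moves the base point (x, y), whence the bracket terms - y d and x d, and
    the quadratic term (x^2 + y^2) / 2 d of the second-order part of
    exp(ad (x X + y Y)) T. *)
Lemma AdE (R : realType) (x y z t a b c d : R) :
  let a' := cos t * a + sin t * b in
  let b' := cos t * b - sin t * a in
  Ad (vec4 x y z t) (vec4 a b c d) =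
  vec4 (a' - y * d) (b' + x * d)
       (c + x * b' - y * a' + (x ^+ 2 + y ^+ 2) / 2 * d) d.
Proof.
move=> a' b'; rewrite /Ad /gmul /ginv !co_vec4.
set f := (X in 'd X _).
evar (df : 'rV[R]_4 -> 'rV[R]_4).
have fP : is_diff (0 : 'rV[R]_4) f df.
  rewrite /f /df; under [X in is_diff _ X _]funext => h do rewrite !co_vec4.
  by differentiate.
rewrite (is_diff_val _ fP) /df; case: (co0 R) => x0 y0 z0 t0.
rewrite /= !x0 !y0 !t0 !co_vec4 /a' /b' !addr0.
have cs := cos2sin2 t.
by congr vec4; field: cs; rewrite ?pnatr_eq0.
Qed.

(** This is K(m^-1) F: orbits are easier to describe through m = g^-1, whose
    adjoint action is the one that appears in the definition of K(g). *)
Definition inv_coadjoint (R : realType) (m F : 'rV[R]_4) : 'rV[R]_4 :=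
  vec4 (coX F * cos (coT m) - coY F * sin (coT m)
          - coZ F * (coX m * sin (coT m) + coY m * cos (coT m)))
       (coX F * sin (coT m) + coY F * cos (coT m)
          + coZ F * (coX m * cos (coT m) - coY m * sin (coT m)))
       (coZ F)
       (coT F - coX F * coY m + coY F * coX m
          + coZ F * ((coX m ^+ 2 + coY m ^+ 2) / 2)).

Lemma coadjointE (R : realType) (g F : 'rV[R]_4) :
  coadjoint g F = inv_coadjoint (ginv g) F.
Proof.
rewrite /coadjoint; set m := ginv g; rewrite [m]vec4_co /inv_coadjoint !co_vec4.
rewrite [F in pairing F]vec4_co.
case: (delta_vec4 R) => eX eY eZ eT.
apply/rowP => -[[|[|[|[|//]]]] i4]; rewrite !mxE /=.
- have -> : Ordinal i4 = @Ordinal 4 0 isT by exact: val_inj.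
  by rewrite eX AdE pairing_vec4; ring.
- have -> : Ordinal i4 = @Ordinal 4 1 isT by exact: val_inj.
  by rewrite eY AdE pairing_vec4; ring.
- have -> : Ordinal i4 = @Ordinal 4 2 isT by exact: val_inj.
  by rewrite eZ AdE pairing_vec4; ring.
- have -> : Ordinal i4 = @Ordinal 4 3 isT by exact: val_inj.
  by rewrite eT AdE pairing_vec4; ring.
Qed.

Lemma ginvK (R : realType) : involutive (@ginv R).
Proof.
move=> g; rewrite [RHS]vec4_co /ginv !co_vec4 cosN sinN.
have cs := cos2sin2 (coT g).
by congr vec4; ring: cs.
Qed.

Lemma coadjoint_orbitE (R : realType) (F : 'rV[R]_4) :
  coadjoint_orbit F = range (fun m => inv_coadjoint m F).
Proof.
apply/seteqP; split=> _ [g _ <-].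
  by exists (ginv g); rewrite // coadjointE.
by exists (ginv g); rewrite // coadjointE ginvK.
Qed.

(** * One-parameter subgroups *)

Lemma eq_of_derive (R : realType) (f g d : R -> R) :
  (forall s : R, is_derive s 1 f (d s)) ->
  (forall s : R, is_derive s 1 g (d s)) ->
  f 0 = g 0 -> f =1 g.
Proof.
move=> fP gP fg0 s; apply/eqP; rewrite -subr_eq0; apply/eqP.
rewrite -(subrr (g 0)) -[X in _ = X - _]fg0.
apply: (@is_derive_0_is_cst R (fun s => f s - g s)) => r.
by apply: is_derive_eq (is_deriveB (fP r) (gP r)) _; rewrite subrr.
Qed.

(** The velocity at 0 of g c(t) when c leaves the neutral element with
    velocity A, that is, the value at g of the left-invariant field A. *)
Definition left_velocity (R : realType) (g A : 'rV[R]_4) : 'rV[R]_4 :=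
  let a' := cos (coT g) * coX A + sin (coT g) * coY A in
  let b' := cos (coT g) * coY A - sin (coT g) * coX A in
  vec4 a' b' (coZ A + (coX g * b' - coY g * a') / 2) (coT A).

Lemma one_param0 (R : realType) (A : 'rV[R]_4) (c : R -> 'rV[R]_4) :
  one_param_subgroup A c -> c 0 = 0.
Proof.
move=> [cD _]; have := cD 0 0; rewrite addr0 {1}[c 0]vec4_co.
move=> /vec4_inj[x y z t].
have t0 : coT (c 0) = 0 by lra.
move: x y z; rewrite t0 cos0 sin0 => x y z.
have x0 : coX (c 0) = 0 by lra.
have y0 : coY (c 0) = 0 by lra.
have z0 : coZ (c 0) = 0 by move: z; rewrite x0 y0; lra.
by rewrite [LHS]vec4_co x0 y0 z0 t0 vec40.
Qed.

(** The homomorphism property c(r) = c(s) c(r - s) transports the derivative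
    at 0 to any other time. *)
Lemma one_param_derive (R : realType) (A : 'rV[R]_4) (c : R -> 'rV[R]_4)
    (s : R) :
  one_param_subgroup A c -> is_derive s 1 c (left_velocity (c s) A).
Proof.
move=> cP; have c0 := one_param0 cP; case: cP => cD /is_derive_diff cA.
apply/is_derive_diff.
have -> : c = fun r => gmul (c s) (c (r - s)).
  by apply/funext => r; rewrite -cD addrC subrK.
have sP : is_diff s (fun r => c (r - s)) (fun h => h *: A).
  have sh : is_diff s (fun r => r - s) id.
    notypeclasses refine (is_diff_eq _ _); first by differentiate.
    by apply/funext => h /=; rewrite oppr0 addr0.
  have cA' : is_diff (s - s) c (fun h => h *: A) by rewrite subrr.
  exact: (is_diff_comp sh cA').
notypeclasses refine (is_diff_eq _ _).
  by rewrite /gmul; differentiate; exact: sP.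
apply/funext => h /=; rewrite !subrr c0.
case: (co0 R) => x0 y0 z0 t0.
rewrite /left_velocity [A]vec4_co !vec4Z !co_vec4 ?x0 ?y0 ?z0 ?t0.
rewrite /= ?oppr0 ?addr0.
congr vec4; ring.
Qed.

(** The equation c' = left_velocity c A is triangular: the right-hand side for
    T is constant, those for X and Y involve T only, and that for Z involves
    T, X and Y.  So the coordinates agree one after the other, in this order. *)
Lemma one_param_unique (R : realType) (A : 'rV[R]_4) (c c' : R -> 'rV[R]_4) :
  one_param_subgroup A c -> one_param_subgroup A c' -> c =1 c'.
Proof.
move=> cP cP'; have e0 : c 0 = c' 0 by rewrite (one_param0 cP) (one_param0 cP').
have D s := (is_derive_diff _ _ _).1 (one_param_derive s cP).
have D' s := (is_derive_diff _ _ _).1 (one_param_derive s cP').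
have eT s : coT (c s) = coT (c' s).
  move: s; apply: (@eq_of_derive R (@coT R \o c) (@coT R \o c')
    (fun=> coT A)) => [s|s|]; last by rewrite /= e0.
    apply/is_derive_diff; apply: is_diff_eq (is_diff_coT (D s)) _.
    by apply/funext => h; rewrite /left_velocity vec4Z co_vec4.
  apply/is_derive_diff; apply: is_diff_eq (is_diff_coT (D' s)) _.
  by apply/funext => h; rewrite /left_velocity vec4Z co_vec4.
have eX s : coX (c s) = coX (c' s).
  move: s; apply: (@eq_of_derive R (@coX R \o c) (@coX R \o c')
    (fun s => coX (left_velocity (c s) A))) => [s|s|].
  - apply/is_derive_diff; apply: is_diff_eq (is_diff_coX (D s)) _.
    by apply/funext => h; rewrite /left_velocity vec4Z !co_vec4.
  - apply/is_derive_diff; apply: is_diff_eq (is_diff_coX (D' s)) _.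
    by apply/funext => h; rewrite /left_velocity vec4Z !co_vec4 (eT s).
  - by rewrite /= e0.
have eY s : coY (c s) = coY (c' s).
  move: s; apply: (@eq_of_derive R (@coY R \o c) (@coY R \o c')
    (fun s => coY (left_velocity (c s) A))) => [s|s|].
  - apply/is_derive_diff; apply: is_diff_eq (is_diff_coY (D s)) _.
    by apply/funext => h; rewrite /left_velocity vec4Z !co_vec4.
  - apply/is_derive_diff; apply: is_diff_eq (is_diff_coY (D' s)) _.
    by apply/funext => h; rewrite /left_velocity vec4Z !co_vec4 (eT s).
  - by rewrite /= e0.
have eZ s : coZ (c s) = coZ (c' s).
  move: s; apply: (@eq_of_derive R (@coZ R \o c) (@coZ R \o c')
    (fun s => coZ (left_velocity (c s) A))) => [s|s|].
  - apply/is_derive_diff; apply: is_diff_eq (is_diff_coZ (D s)) _.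
    by apply/funext => h; rewrite /left_velocity vec4Z !co_vec4.
  - apply/is_derive_diff; apply: is_diff_eq (is_diff_coZ (D' s)) _.
    apply/funext => h; rewrite /left_velocity vec4Z !co_vec4.
    by rewrite (eT s) (eX s) (eY s).
  - by rewrite /= e0.
by move=> s; rewrite [LHS]vec4_co [RHS]vec4_co (eT s) (eX s) (eY s) (eZ s).
Qed.

(** With w = x + i y and zeta = a + i b, integrating w' = zeta exp(- i d s)
    gives w, and then z' = c + Im (conj w * w') / 2 gives the Z coordinate.
    For d = 0 the curve is a straight line. *)
Definition one_param (R : realType) (A : 'rV[R]_4) (s : R) : 'rV[R]_4 :=
  let d := coT A in
  if d == 0 then s *: A else
  vec4 ((coX A * sin (d * s) + coY A * (1 - cos (d * s))) / d)
       ((coY A * sin (d * s) - coX A * (1 - cos (d * s))) / d)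
       (coZ A * s
          - (coX A ^+ 2 + coY A ^+ 2) / (2 * d) * (s - sin (d * s) / d))
       (d * s).

Lemma one_paramP (R : realType) (A : 'rV[R]_4) :
  one_param_subgroup A (one_param A).
Proof.
rewrite /one_param; set d := coT A.
have [d0|d0] := eqVneq d 0; split.
- move=> s t; rewrite [A]vec4_co -/d d0 !vec4Z /gmul !co_vec4 !mulr0 cos0 sin0.
  by congr vec4; field.
- apply/is_derive_diff; exact: is_diff_scalev (is_diff_id _).
- move=> s t; rewrite /gmul !co_vec4 mulrDr cosD sinD.
  have cs := cos2sin2 (d * s).
  by congr vec4; field: cs.
- apply/is_derive_diff; notypeclasses refine (is_diff_eq _ _); first by differentiate.
  apply/funext => h /=; rewrite !mulr0 cos0 sin0 [A in RHS]vec4_co vec4Z.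
  by rewrite -/d; congr vec4; field.
Qed.

(** Uniqueness applied to s A, one of whose one-parameter subgroups is
    r |-> one_param A (s r). *)
Lemma gexpE (R : realType) (A : 'rV[R]_4) (s : R) :
  gexp (s *: A) = one_param A s.
Proof.
have [cD /is_derive_diff cA] := one_paramP A.
have sP : one_param_subgroup (s *: A) (fun r => one_param A (s * r)).
  split; first by move=> r r'; rewrite mulrDr cD.
  have ms : is_diff (0 : R) (fun r => s * r) (fun h => s * h).
    notypeclasses refine (is_diff_eq _ _); first by differentiate.
    by apply/funext => h /=; rewrite mul0r addr0.
  have cA' : is_diff (s * 0) (one_param A) (fun h => h *: A) by rewrite mulr0.
  apply/is_derive_diff; apply: is_diff_eq (is_diff_comp ms cA') _.
  by apply/funext => h /=; rewrite scalerA mulrC.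
apply: xget_unique => [|g [c cP ->]].
  by exists (fun r => one_param A (s * r)) => //; rewrite mulr1.
by rewrite (one_param_unique cP sP) mulr1.
Qed.

Lemma gmul_eq0 (R : realType) (g h : 'rV[R]_4) : gmul g h = 0 -> ginv h = g.
Proof.
rewrite -vec40 => /vec4_inj[x y z t].
have tE : coT g = - coT h by lra.
move: x y z; rewrite tE cosN sinN => x y z.
rewrite [RHS]vec4_co /ginv; congr vec4; [lra|lra| |lra].
have xE : coX g = - (cos (coT h) * coX h + - sin (coT h) * coY h) by lra.
have yE : coY g = - (cos (coT h) * coY h - - sin (coT h) * coX h) by lra.
move: z; rewrite xE yE => z.
have : coZ g + coZ h = 0 by rewrite -z; field.
by lra.
Qed.

Lemma ginv_one_param (R : realType) (A : 'rV[R]_4) (s : R) :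
  ginv (one_param A (- s)) = one_param A s.
Proof.
have cP := one_paramP A; apply: gmul_eq0.
by rewrite -(cP.1 s) subrr (one_param0 cP).
Qed.

(** K(exp(- t A)) F is <F, Ad(exp(t A)) . >, because exp(- t A) has inverse
    exp(t A); its derivative at t = 0 is <F, [A, .]>. *)
Lemma xiE (R : realType) (A F : 'rV[R]_4) :
  xi A F = vec4 (- (coY F * coT A) - coZ F * coY A)
                (coX F * coT A + coZ F * coX A)
                0 (coY F * coX A - coX F * coY A).
Proof.
have cP := one_paramP A; have c0 := one_param0 cP.
case: cP => _ /is_derive_diff cA.
rewrite /xi (_ : (fun t => _) = fun t => inv_coadjoint (one_param A t) F); last first.
  by apply/funext => t; rewrite -scaleNr gexpE coadjointE ginv_one_param.
evar (w : R -> 'rV[R]_4).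
have fP : is_diff (0 : R) (fun t => inv_coadjoint (one_param A t) F) w.
  by rewrite /inv_coadjoint /w; differentiate; exact: cA.
rewrite deriveE; last by case: fP.
rewrite (is_diff_val _ fP) /w /= c0 !scale1r.
case: (co0 R) => x0 y0 z0 t0; rewrite ?x0 ?y0 ?z0 ?t0 cos0 sin0.
by congr vec4; field.
Qed.

(** * The Kirillov form *)

Lemma pairing_lie_bracket (R : realType) (F A B : 'rV[R]_4) :
  pairing F (lie_bracket A B) = pairing (xi A F) B.
Proof.
by rewrite xiE [F in LHS]vec4_co [B in RHS]vec4_co !pairing_vec4; ring.
Qed.

Lemma lie_bracketC (R : realType) (A B : 'rV[R]_4) :
  lie_bracket A B = - lie_bracket B A.
Proof.
rewrite /lie_bracket -[RHS]scaleN1r vec4Z; congr vec4; ring.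
Qed.

Lemma pairingN (R : realType) (F A : 'rV[R]_4) : pairing F (- A) = - pairing F A.
Proof. by rewrite /pairing -sumrN; apply: eq_bigr => i _; rewrite mxE mulrN. Qed.

(** The value <F, [A, B]> = <xi A F, B> = - <xi B F, A> is unchanged when A or
    B is replaced by another vector that induces the same tangent vector. *)
Lemma kirillov_formE (R : realType) (F A B : 'rV[R]_4) :
  kirillov_form F (xi A F) (xi B F) = pairing F (lie_bracket A B).
Proof.
apply: xget_unique => [|r [A' [B' [eA eB ->]]]]; first by exists A, B.
rewrite !pairing_lie_bracket eA -!pairing_lie_bracket.
rewrite lie_bracketC pairingN [in RHS]lie_bracketC [in RHS]pairingN.
by rewrite !pairing_lie_bracket eB.
Qed.

(** Here A m v is a Lie algebra element inducing the tangent vector of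
    coordinates v at psi m; since <F, [A, B]> = <xi_A(F), B>, pairing a tangent
    vector with it evaluates the Kirillov form. *)
Lemma kirillov_chart (R : realType) (U : set (R * R))
    (psi : R * R -> 'rV[R]_4) (f : R -> R -> R)
    (A : R * R -> R * R -> 'rV[R]_4) :
  (forall m v, U m -> 'd psi m v = xi (A m v) (psi m)) ->
  (forall m u v, U m -> pairing ('d psi m u) (A m v) =
                        f m.1 m.2 * (u.1 * v.2 - u.2 * v.1)) ->
  kirillov_in_chart U psi f.
Proof.
move=> dpsi area p q Um u v.
by rewrite -(area (p, q) u v Um) !dpsi// kirillov_formE pairing_lie_bracket.
Qed.

(** * Coadjoint orbits *)

Lemma inv_coadjoint_vec4 (R : realType) (x y z t a b c d : R) :
  inv_coadjoint (vec4 x y z t) (vec4 a b c d) =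
  vec4 (a * cos t - b * sin t - c * (x * sin t + y * cos t))
       (a * sin t + b * cos t + c * (x * cos t - y * sin t))
       c (d - a * y + b * x + c * ((x ^+ 2 + y ^+ 2) / 2)).
Proof. by rewrite /inv_coadjoint !co_vec4. Qed.

Lemma trivial_orbit (R : realType) (delta : R) :
  coadjoint_orbit (vec4 0 0 0 delta) = [set vec4 0 0 0 delta].
Proof.
rewrite coadjoint_orbitE; apply/seteqP; split=> [_ [m _ <-]|_ ->].
  by rewrite [m]vec4_co inv_coadjoint_vec4; congr vec4; ring.
exists (vec4 0 0 0 0) => //; rewrite inv_coadjoint_vec4 cos0 sin0.
by congr vec4; field.
Qed.

(** The rotation angle is free, and - alpha y + beta x takes every value since
    (alpha, beta) is not zero. *)
Lemma cylinder_orbit (R : realType) (alpha beta delta : R) :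
  alpha ^+ 2 + beta ^+ 2 <> 0 ->
  coadjoint_orbit (vec4 alpha beta 0 delta) =
    [set F' | exists theta t : R,
       F' = vec4 (alpha * cos theta - beta * sin theta)
                 (alpha * sin theta + beta * cos theta) 0 t].
Proof.
move=> /eqP ab0; rewrite coadjoint_orbitE.
apply/seteqP; split=> [_ [m _ <-]|_ /= [theta [t ->]]].
  rewrite [m]vec4_co inv_coadjoint_vec4; eexists; eexists.
  by rewrite !mul0r subr0 !addr0.
exists (vec4 ((t - delta) * beta / (alpha ^+ 2 + beta ^+ 2))
             (- ((t - delta) * alpha / (alpha ^+ 2 + beta ^+ 2))) 0 theta) => //.
by rewrite inv_coadjoint_vec4; congr vec4; field.
Qed.

(** The function x^2 + y^2 - 2 gamma t is constant on the orbit.  Conversely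
    the translations by (x, y) alone, without rotation, move (alpha, beta) to
    any point of the plane, and the invariant then fixes the last coordinate. *)
Lemma paraboloid_orbit (R : realType) (alpha beta gamma delta : R) :
  gamma <> 0 ->
  coadjoint_orbit (vec4 alpha beta gamma delta) =
    [set F' | exists x y t : R,
       F' = vec4 x y gamma t /\
       x ^+ 2 + y ^+ 2 - 2 * gamma * t =
       alpha ^+ 2 + beta ^+ 2 - 2 * gamma * delta].
Proof.
move=> /eqP g0; rewrite coadjoint_orbitE.
apply/seteqP; split=> [_ [m _ <-]|_ /= [x [y [t [-> inv]]]]].
  rewrite [m]vec4_co inv_coadjoint_vec4; do 3!eexists; split; first by [].
  have cs := cos2sin2 (coT m).
  by field: cs.
exists (vec4 ((y - beta) / gamma) ((alpha - x) / gamma) 0 0) => //.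
rewrite inv_coadjoint_vec4 cos0 sin0.
have -> : t = (x ^+ 2 + y ^+ 2 - (alpha ^+ 2 + beta ^+ 2 - 2 * gamma * delta))
              / (2 * gamma) by rewrite -inv; field.
by congr vec4; field.
Qed.

(** * Smoothness of trigonometric polynomials *)

Lemma smooth_of_stable (R : realType) (V W : normedModType R)
    (C : set (V -> W)) (U : set V) :
  (forall f, C f -> forall x, differentiable f x) ->
  (forall f, C f -> forall v, C (fun x => 'D_v f x)) ->
  forall f, C f -> smooth_on U f.
Proof.
move=> Cd CD f Cf n; elim: n f Cf => [|n IHn] f Cf /=.
  by move=> x _; apply: differentiable_continuous; exact: Cd.
by split=> [x _|v]; [exact: Cd | apply: IHn; exact: CD].
Qed.

(** The functions of (p, q) that are polynomial in p, cos q and sin q.  No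
    normal form is needed: closure under derivation is read off the
    constructors. *)
Inductive trig_poly (R : realType) : (R * R -> R) -> Prop :=
| TrigConst (a : R) : trig_poly (fun=> a)
| TrigVar : trig_poly (fun m => m.1)
| TrigCos : trig_poly (fun m => cos m.2)
| TrigSin : trig_poly (fun m => sin m.2)
| TrigAdd f g : trig_poly f -> trig_poly g -> trig_poly (fun m => f m + g m)
| TrigOpp f : trig_poly f -> trig_poly (fun m => - f m)
| TrigMul f g : trig_poly f -> trig_poly g -> trig_poly (fun m => f m * g m).

Lemma trig_poly_diff (R : realType) (f : R * R -> R) : trig_poly f ->
  exists df : R * R -> R * R -> R,
    (forall v, trig_poly (fun m => df m v)) /\ forall m, is_diff m f (df m).
Proof.
elim=> {f} [a||||f g _ [df [fT fD]] _ [dg [gT gD]]|f _ [df [fT fD]]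
           |f g fT0 [df [fT fD]] gT0 [dg [gT gD]]].
- exists (fun _ _ => 0); split=> [v|m]; first exact: TrigConst.
  exact: is_diff_const.
- exists (fun _ v => v.1); split=> [v|m]; first exact: TrigConst.
  exact: is_diff_fst.
- exists (fun m v => - sin m.2 * v.2); split=> [v|m].
    exact: TrigMul (TrigOpp (TrigSin _)) (TrigConst _).
  exact: is_diff_cos (is_diff_snd _).
- exists (fun m v => cos m.2 * v.2); split=> [v|m].
    exact: TrigMul (TrigCos _) (TrigConst _).
  exact: is_diff_sin (is_diff_snd _).
- exists (fun m v => df m v + dg m v); split=> [v|m].
    exact: TrigAdd (fT v) (gT v).
  exact: is_diff_add.
- exists (fun m v => - df m v); split=> [v|m]; first exact: TrigOpp (fT v).
  exact: is_diff_opp.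
- exists (fun m v => f m * dg m v + g m * df m v); split=> [v|m].
    exact: TrigAdd (TrigMul fT0 (gT v)) (TrigMul gT0 (fT v)).
  exact: is_diff_mul.
Qed.

Lemma trig_poly_smooth (R : realType) (U : set (R * R)) (f g h k : R * R -> R) :
  trig_poly f -> trig_poly g -> trig_poly h -> trig_poly k ->
  smooth_on U (fun m => vec4 (f m) (g m) (h m) (k m)).
Proof.
move=> fT gT hT kT.
pose C (F : R * R -> 'rV[R]_4) := exists f g h k : R * R -> R,
  [/\ trig_poly f, trig_poly g, trig_poly h & trig_poly k] /\
  F = fun m => vec4 (f m) (g m) (h m) (k m).
have CP F : C F -> exists dF : R * R -> R * R -> 'rV[R]_4,
    (forall v, C (fun m => dF m v)) /\ forall m, is_diff m F (dF m).
  move=> [f' [g' [h' [k' [[/trig_poly_diff[df [fT' fD]]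
    /trig_poly_diff[dg [gT' gD]] /trig_poly_diff[dh [hT' hD]]
    /trig_poly_diff[dk [kT' kD]]] ->]]]]].
  exists (fun m v => vec4 (df m v) (dg m v) (dh m v) (dk m v)).
  split=> [v|m]; last exact: is_diff_vec4.
  by exists (df^~ v), (dg^~ v), (dh^~ v), (dk^~ v).
apply: (@smooth_of_stable R _ _ C) => [F /CP[dF [_ FD]] m|F /CP[dF [dC FD]] v|].
- by case: (FD m).
- rewrite (_ : (fun x => _) = fun m => dF m v) //; apply/funext => m.
  by rewrite deriveE ?(is_diff_val _ (FD m)) //; case: (FD m).
- by exists f, g, h, k.
Qed.

(** * The angle of a unit vector *)

Lemma trigD2kpi (R : realType) (k : int) (x : R) :
  cos (x + 2 * k%:~R * pi) = cos x /\ sin (x + 2 * k%:~R * pi) = sin x.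
Proof.
have nat_case n y : cos (y + 2 * n%:R * pi) = cos y /\
                    sin (y + 2 * n%:R * pi) = sin y :> R.
  have -> : 2 * n%:R * pi = pi *+ 2 *+ n :> R.
    by rewrite -[RHS]mulr_natl -[pi *+ 2]mulr_natl mulrA [n%:R * 2]mulrC.
  by rewrite (periodicn (@cosD2pi R)) (periodicn (@sinD2pi R)).
case: k => n; first exact: nat_case.
have [<- <-] := nat_case n.+1 (x + 2 * (Negz n)%:~R * pi).
by rewrite NegzE mulrNz mulrN mulNr subrK.
Qed.

Lemma cos_neq1 (R : realType) (x : R) : 0 < x < 2 * pi -> cos x != 1.
Proof.
move=> /andP[x0 x2]; have s0 : 0 < sin (x / 2) by apply: sin_gt0_pi; lra.
have -> : x = x / 2 *+ 2 by rewrite -mulr_natr divfK ?pnatr_eq0.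
rewrite cos_mulr2n cos2sin2 -subr_eq0.
have -> : (1 - sin (x / 2) ^+ 2) *+ 2 - 1 - 1 = - 2 * sin (x / 2) ^+ 2 by ring.
by rewrite mulf_neq0 ?oppr_eq0 ?pnatr_eq0// expf_neq0 ?gt_eqF.
Qed.

Lemma cos_Iint_neq1 (R : realType) (k : int) (q : R) : Iint k q -> cos q != 1.
Proof.
move=> /= /andP[q1 q2].
have [h _] := trigD2kpi k (q - 2 * k%:~R * pi); rewrite subrK in h.
by rewrite h; apply: cos_neq1; lra.
Qed.

(** Two such angles differ by less than 2 pi, while the cosine of their
    difference is 1. *)
Lemma Iint_trig_inj (R : realType) (k : int) (q q' : R) :
  Iint k q -> Iint k q' -> cos q = cos q' -> sin q = sin q' -> q = q'.
Proof.
wlog qq' : q q' / q <= q' => [H Iq Iq' c s|].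
  by have [h|/ltW h] := lerP q q'; [exact: H|apply/esym/H].
move=> /= /andP[q1 _] /andP[_ q2] c s; apply/eqP; move: qq'.
rewrite le_eqVlt => /orP[//|lt]; have /cos_neq1/eqP[] : 0 < q' - q < 2 * pi by lra.
by rewrite cosB c s -!expr2 cos2Dsin2.
Qed.

(** With c = cos q and s = sin q, - s / (1 - c) = - cot (q / 2)
    = tan (q / 2 - pi / 2): this half-angle formula covers the circle minus
    the point (1, 0) with a single continuous branch. *)
Definition angle (R : realType) (k : int) (c s : R) : R :=
  pi + 2 * atan (- (s / (1 - c))) + 2 * k%:~R * pi.

Lemma angle_in (R : realType) (k : int) (c s : R) : Iint k (angle k c s).
Proof.
rewrite /Iint /angle /=.
have := atan_gtNpi2 (- (s / (1 - c))); have := atan_ltpi2 (- (s / (1 - c))).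
by move: (atan _) => y; lra.
Qed.

(** Writing y for the arctangent, tan y = - s / (1 - c) yields
    cos^2 y = (1 - c) / 2, and the angle is pi + 2 y modulo 2 pi. *)
Lemma trig_angle (R : realType) (k : int) (c s : R) :
  c ^+ 2 + s ^+ 2 = 1 -> c != 1 ->
  cos (angle k c s) = c /\ sin (angle k c s) = s.
Proof.
move=> cs c1; have c1' : 1 - c != 0 by rewrite subr_eq0 eq_sym.
rewrite /angle; have [-> ->] := trigD2kpi k (pi + 2 * atan (- (s / (1 - c)))).
rewrite [pi + _]addrC cosDpi sinDpi mulr_natl cos_mulr2n sin_mulr2n.
have := atanK (- (s / (1 - c))); set y := atan _.
have y0 : cos y != 0.
  by rewrite gt_eqF// cos_gt0_pihalf// atan_gtNpi2 atan_ltpi2.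
have := cos2Dsin2 y.
rewrite /tan; move: (cos y) (sin y) y0 => C S C0 CS /(congr1 ( *%R^~ C)).
rewrite divfK// => SE; rewrite SE in CS *.
have s2 : s ^+ 2 = 1 - c ^+ 2 by rewrite -cs; ring.
have C2 : C ^+ 2 * 2 = 1 - c.
  have : C ^+ 2 * 2 * (1 - c) = (1 - c) ^+ 2.
    by rewrite -[RHS]mulr1 -[X in _ = _ * X]CS; field: s2.
  by rewrite [RHS]expr2 => /(mulIf c1').
split; first by rewrite -[_ *+ 2]mulr_natr C2; ring.
have -> : - (C * (- (s / (1 - c)) * C) *+ 2) = s / (1 - c) * (C ^+ 2 * 2) by ring.
by rewrite C2 divfK.
Qed.

(** * Polar charts *)

Lemma continuous_angle (R : realType) (T : topologicalType) (k : int)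
    (c s : T -> R) (v : T) : c v != 1 ->
  {for v, continuous c} -> {for v, continuous s} ->
  {for v, continuous (fun w => angle k (c w) (s w))}.
Proof.
move=> c1 cc cs.
have h : {for v, continuous (fun w => - (s w / (1 - c w)))}.
  apply: continuousN; apply: cvgM => //.
  apply: cvgV; first by rewrite subr_eq0 eq_sym.
  by apply: cvgB => //; exact: cvg_cst.
have ha := continuous_comp h (@continuous_atan R _).
rewrite /angle; apply: cvgD; last exact: cvg_cst.
apply: cvgD; first exact: cvg_cst.
by apply: cvgM; [exact: cvg_cst|exact: ha].
Qed.

Lemma open_Iint (R : realType) (k : int) : open (@Iint R k).
Proof.
rewrite (_ : Iint k = [set q | 2 * k%:~R * pi < q] `&`
                      [set q | q < 2 * pi + 2 * k%:~R * pi]).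
  by apply: openI; [exact: open_gt|exact: open_lt].
by apply/seteqP; split=> q /= /andP.
Qed.

Lemma open_setX (S T : topologicalType) (A : set S) (B : set T) :
  open A -> open B -> open (A `*` B).
Proof.
rewrite !openE => oA oB [a b] [/= Aa Bb].
by exists (A, B) => //; split; [exact: oA|exact: oB].
Qed.

(** A surface Om with a radial coordinate p and the cosine c and sine s of an
    angle, all continuous on an open set W that contains the image of psi.
    Then v |-> (p v, angle (c v) (s v)) is a left inverse of psi, continuous
    where c <> 1; so the image of an open O is cut out of Om by the preimage
    of O under it. *)
Lemma polar_chart (R : realType) (Om W : set 'rV[R]_4) (J : set R) (k : int)
    (psi : R * R -> 'rV[R]_4) (p c s : 'rV[R]_4 -> R) :
  open J -> smooth_on (J `*` Iint k) psi ->
  (forall m, (J `*` Iint k) m -> injective ('d psi m)) ->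
  open W ->
  (forall v, W v -> [/\ {for v, continuous p}, {for v, continuous c} &
                        {for v, continuous s}]) ->
  (forall r q, J r -> let v := psi (r, q) in
     [/\ Om v, W v, p v = r, c v = cos q & s v = sin q]) ->
  (forall v, Om v -> W v -> c v ^+ 2 + s v ^+ 2 = 1 /\
     forall q, cos q = c v -> sin q = s v -> psi (p v, q) = v) ->
  local_chart Om (J `*` Iint k) psi.
Proof.
move=> oJ sm imm oW cont psiP inv; split => //.
- by apply: open_setX => //; exact: open_Iint.
- move=> [r q] [r' q'] /set_mem[/= Jr Iq] /set_mem[/= Jr' Iq'] e.
  have [_ _] := psiP r q Jr; have [_ _] := psiP r' q' Jr'; rewrite e.
  move=> -> -> -> -> ec es; congr pair; exact: Iint_trig_inj Iq' _ _.
- move=> O oO OU.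
  pose g v := (p v, angle k (c v) (s v)).
  exists [set v | [/\ W v, c v != 1 & O (g v)]].
    rewrite openE => v [Wv cv Ogv]; have [pc cc sc] := cont v Wv.
    have nW : \forall w \near v, W w by exact: (open_nbhs_nbhs (conj oW Wv)).
    have nc : \forall w \near v, c w != 1.
      exact: (cc _ (open_nbhs_nbhs (conj (open_neq (y := 1)) cv))).
    have gc : {for v, continuous g}.
      exact: (cvg_pair pc (continuous_angle cv cc sc)).
    have nO : \forall w \near v, O (g w) by exact: (gc O (open_nbhs_nbhs (conj oO Ogv))).
    by apply: filterS3 nW nc nO => w; split.
  apply/seteqP; split=> [_ [[r q] Orq <-]|v [Omv [Wv cv Ogv]]].
    have [/= Jr Iq] := OU _ Orq; have [Om_ W_ pE cE sE] := psiP r q Jr.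
    split=> //; split=> //; first by rewrite cE; exact: cos_Iint_neq1 Iq.
    rewrite /g pE cE sE.
    have [ca sa] := trig_angle k (cos2Dsin2 q) (cos_Iint_neq1 Iq).
    by rewrite (Iint_trig_inj (angle_in _ _ _) Iq ca sa).
  have [cs psig] := inv v Omv Wv; have [ca sa] := trig_angle k cs cv.
  by exists (g v) => //; exact: psig.
Qed.

(** * The cylinder orbits *)

Definition cylinder_chart (R : realType) (alpha beta : R) (m : R * R) :
    'rV[R]_4 :=
  vec4 (alpha * cos m.2 - beta * sin m.2)
       (alpha * sin m.2 + beta * cos m.2) 0 m.1.

Lemma diff_cylinder_chart (R : realType) (alpha beta : R) (m v : R * R) :
  'd (cylinder_chart alpha beta) m v =
  vec4 (- (alpha * sin m.2 + beta * cos m.2) * v.2)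
       ((alpha * cos m.2 - beta * sin m.2) * v.2) 0 v.1.
Proof.
evar (df : R * R -> 'rV[R]_4).
have fP : is_diff m (cylinder_chart alpha beta) df.
  by rewrite /cylinder_chart /df; differentiate.
by rewrite (is_diff_val _ fP) /df; congr vec4; ring.
Qed.

Lemma cylinder_local_chart (R : realType) (alpha beta delta : R) (k : int) :
  alpha ^+ 2 + beta ^+ 2 <> 0 ->
  local_chart (coadjoint_orbit (vec4 alpha beta 0 delta))
    ([set: R] `*` Iint k) (cylinder_chart alpha beta).
Proof.
move=> ab0; rewrite cylinder_orbit//; move/eqP: ab0 => ab0.
have rho (m : R * R) : (alpha * cos m.2 - beta * sin m.2) ^+ 2 +
             (alpha * sin m.2 + beta * cos m.2) ^+ 2 = alpha ^+ 2 + beta ^+ 2.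
  by rewrite -[RHS]mulr1 -(cos2Dsin2 m.2); ring.
pose c (v : 'rV[R]_4) := (alpha * coX v + beta * coY v) / (alpha ^+ 2 + beta ^+ 2).
pose s (v : 'rV[R]_4) := (alpha * coY v - beta * coX v) / (alpha ^+ 2 + beta ^+ 2).
apply: (@polar_chart R _ setT _ k _ (@coT R) c s).
- exact: openT.
- by apply: trig_poly_smooth; do ?constructor.
- move=> m _ u v; rewrite !diff_cylinder_chart => /vec4_inj[x y _ t].
  rewrite [u]surjective_pairing [v]surjective_pairing t; congr pair.
  apply: (mulfI ab0); rewrite -(rho m).
  have E (a b w : R) : (a ^+ 2 + b ^+ 2) * w = a * (a * w) - b * (- b * w) by ring.
  by rewrite !E x y.
- exact: openT.
- move=> v _; split; first exact: coord_continuous.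
  + by apply: is_diff_continuous; rewrite /c; differentiate.
  + by apply: is_diff_continuous; rewrite /s; differentiate.
- move=> r q _ v; rewrite /v /c /s /cylinder_chart !co_vec4 /=; split => //.
  + by exists q, r.
  + by field.
  + by field.
- move=> _ [theta [t ->]] _; rewrite /c /s !co_vec4; split.
    have cs := cos2sin2 theta.
    by field: cs.
  move=> q cq sq; rewrite /cylinder_chart /= cq sq.
  by congr vec4; field.
Qed.

(** The coordinate q is the time of the flow of xi_T, and the vertical
    direction is induced by an element of the plane spanned by X and Y,
    normalised by y a - x b = 1. *)
Lemma cylinder_kirillov (R : realType) (alpha beta : R) (U : set (R * R)) :
  alpha ^+ 2 + beta ^+ 2 <> 0 ->
  kirillov_in_chart U (cylinder_chart alpha beta) (fun _ _ => 1).
Proof.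
move=> /eqP ab0.
pose x (m : R * R) := alpha * cos m.2 - beta * sin m.2.
pose y (m : R * R) := alpha * sin m.2 + beta * cos m.2.
have rho m : x m ^+ 2 + y m ^+ 2 = alpha ^+ 2 + beta ^+ 2.
  by rewrite -[RHS]mulr1 -(cos2Dsin2 m.2) /x /y; ring.
have rho0 m : x m ^+ 2 + y m ^+ 2 != 0 by rewrite rho.
pose A m (v : R * R) := vec4 (v.1 * y m / (x m ^+ 2 + y m ^+ 2))
                             (- (v.1 * x m / (x m ^+ 2 + y m ^+ 2))) 0 v.2.
apply: (@kirillov_chart R _ _ _ A) => [m v _|m u v _].
  rewrite diff_cylinder_chart xiE /A /cylinder_chart !co_vec4.
  rewrite -/(x m) -/(y m); congr vec4; try by ring.
  by field.
rewrite diff_cylinder_chart /A pairing_vec4 -/(x m) -/(y m).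
by field.
Qed.

(** * The paraboloid orbits *)

(** The last component solves p^2 - 2 gamma t = alpha^2 + beta^2
    - 2 gamma delta for t when e = delta - (alpha^2 + beta^2) / (2 gamma). *)
Definition paraboloid_chart (R : realType) (gamma e : R) (m : R * R) :
    'rV[R]_4 :=
  vec4 (m.1 * cos m.2) (m.1 * sin m.2) gamma (m.1 * m.1 * (2 * gamma)^-1 + e).

Lemma diff_paraboloid_chart (R : realType) (gamma e : R) (m v : R * R) :
  gamma != 0 ->
  'd (paraboloid_chart gamma e) m v =
  vec4 (v.1 * cos m.2 - m.1 * sin m.2 * v.2)
       (v.1 * sin m.2 + m.1 * cos m.2 * v.2) 0 (v.1 * m.1 / gamma).
Proof.
move=> g0; evar (df : R * R -> 'rV[R]_4).
have fP : is_diff m (paraboloid_chart gamma e) df.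
  by rewrite /paraboloid_chart /df; differentiate.
by rewrite (is_diff_val _ fP) /df; congr vec4; field.
Qed.

Lemma half_line_neq0 (R : realType) (s : bool) (r : R) : half_line s r -> r != 0.
Proof. by case: s => /=; [move/gt_eqF->|move/lt_eqF->]. Qed.

Lemma open_half_line (R : realType) (s : bool) : open (@half_line R s).
Proof. by case: s; [exact: open_gt|exact: open_lt]. Qed.

Lemma half_line_norm (R : realType) (s : bool) (r : R) :
  half_line s r -> (if s then 1 else -1) * `|r| = r.
Proof.
by case: s => /= r0; [rewrite gtr0_norm// mul1r|rewrite ltr0_norm// mulN1r opprK].
Qed.

(** The signed radius p = +-sqrt(x^2 + y^2) and the unit vector (x / p, y / p)
    recover (p, q) off the vertex, where p = 0. *)
Lemma paraboloid_local_chart (R : realType) (alpha beta gamma delta : R)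
    (s : bool) (k : int) : gamma <> 0 ->
  local_chart (coadjoint_orbit (vec4 alpha beta gamma delta))
    (half_line s `*` Iint k)
    (paraboloid_chart gamma
       (delta - (alpha ^+ 2 + beta ^+ 2) / (2 * gamma))).
Proof.
move=> gamma0; rewrite paraboloid_orbit//; move/eqP: gamma0 => g0.
pose sg : R := if s then 1 else -1.
have sg2 : sg ^+ 2 = 1 by rewrite /sg; case: (s); ring.
pose p (v : 'rV[R]_4) := sg * Num.sqrt (coX v ^+ 2 + coY v ^+ 2).
have pE v : p v ^+ 2 = coX v ^+ 2 + coY v ^+ 2.
  by rewrite /p exprMn sg2 mul1r sqr_sqrtr// addr_ge0 ?sqr_ge0.
have cX : continuous (@coX R) by exact: coord_continuous.
have cY : continuous (@coY R) by exact: coord_continuous.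
have pC v : {for v, continuous p}.
  have h : {for v, continuous (fun v : 'rV[R]_4 => coX v ^+ 2 + coY v ^+ 2)}.
    by apply: is_diff_continuous; differentiate.
  have hs := continuous_comp h (@sqrt_continuous R _).
  exact: (continuousM (@cst_continuous _ _ sg v) hs).
apply: (@polar_chart R _ [set v | p v != 0] _ k _ p (fun v => coX v / p v)
         (fun v => coY v / p v)).
- exact: open_half_line.
- by apply: trig_poly_smooth; do ?constructor.
- move=> m [/= /half_line_neq0 r0 _] u v.
  rewrite !diff_paraboloid_chart// => /vec4_inj[x y _ t].
  have u1 : u.1 = v.1.
    by apply: (mulIf r0); apply: (mulIf (_ : gamma^-1 != 0)); rewrite ?invr_eq0.
  rewrite [u]surjective_pairing [v]surjective_pairing u1; congr pair.
  rewrite u1 in x y; have x' : m.1 * sin m.2 * u.2 = m.1 * sin m.2 * v.2 by lra.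
  have y' : m.1 * cos m.2 * u.2 = m.1 * cos m.2 * v.2 by lra.
  have E w : m.1 * w = cos m.2 * (m.1 * cos m.2 * w) + sin m.2 * (m.1 * sin m.2 * w).
    by rewrite -[LHS]mul1r -[X in X * _ = _](cos2Dsin2 m.2); ring.
  by apply: (mulfI r0); rewrite E x' y' -E.
- rewrite openE => v pv.
  exact: (pC v _ (open_nbhs_nbhs (conj (open_neq (y := 0)) pv))).
- move=> v /= pv; split; first exact: pC.
    exact: (continuousM (cX v) (continuousV pv (pC v))).
  exact: (continuousM (cY v) (continuousV pv (pC v))).
- move=> r q Jr v; have r0 := half_line_neq0 Jr.
  have pv : p v = r.
    rewrite /p /v /paraboloid_chart !co_vec4 /= !exprMn -mulrDr cos2Dsin2 mulr1.
    by rewrite sqrtr_sqr /sg half_line_norm.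
  rewrite /= pv /v /paraboloid_chart !co_vec4 /=; split => //; last 2 first.
  + by rewrite mulrC mulKf.
  + by rewrite mulrC mulKf.
  exists (r * cos q), (r * sin q); eexists; split; first by [].
  rewrite !exprMn -mulrDr cos2Dsin2; field.
  by [].
- move=> v [x [y [t [vE inv]]]] /= pv; split.
    by rewrite !exprMn -mulrDl -pE -exprMn divff// expr1n.
  move=> q cq sq; rewrite /paraboloid_chart /= cq sq -expr2 pE ![p v * _]mulrC !divfK//.
  rewrite [RHS]vE vE !co_vec4; congr vec4.
  have -> : t = (x ^+ 2 + y ^+ 2 - (alpha ^+ 2 + beta ^+ 2 - 2 * gamma * delta))
                / (2 * gamma) by rewrite -inv; field.
  by field.
Qed.

(** Again xi_T is the velocity of q.  Since gamma <> 0, the elements of the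
    plane spanned by X and Y induce tangent vectors with arbitrary first two
    components gamma (- b, a), which gives the velocity of p. *)
Lemma paraboloid_kirillov (R : realType) (gamma e : R)
    (U : set (R * R)) :
  gamma <> 0 ->
  kirillov_in_chart U (paraboloid_chart gamma e)
    (fun p _ => p / gamma).
Proof.
move=> /eqP g0.
pose A (m v : R * R) := vec4 (v.1 * sin m.2 / gamma) (- (v.1 * cos m.2 / gamma))
  0 v.2.
apply: (@kirillov_chart R _ _ _ A) => [m v _|m u v _].
  rewrite diff_paraboloid_chart// xiE /A /paraboloid_chart !co_vec4.
  have cs := cos2sin2 m.2.
  by congr vec4; field: cs.
rewrite diff_paraboloid_chart// /A pairing_vec4.
have cs := cos2sin2 m.2.
by field: cs.
Qed.

(** * The charts of the nontrivial orbits *)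

Lemma expiE (R : realType) (q : R) : expi q = ((cos q)%:C + 'i * (sin q)%:C)%C.
Proof. by rewrite /expi; simpc. Qed.

(** Euler's formula, in the form shared by the complex expressions of the two
    cases. *)
Lemma half_expi_sum (R : realType) (u v q : R) :
  (2^-1 * (u%:C - 'i * v%:C) * expi q + 2^-1 * (u%:C + 'i * v%:C) * expi (- q)
   = (u * cos q + v * sin q)%:C)%C.
Proof.
rewrite !expiE cosN sinN.
have i2 : (('i : R[i]) ^+ 2 = -1)%C by rewrite sqr_i.
by field: i2.
Qed.

Theorem proposition4p1p2 (R : realType) (alpha beta gamma delta : R)
    (F := vec4 alpha beta gamma delta)
    (nontrivF : nontrivial_orbit F) :
  [/\ (gamma = 0 /\ alpha ^+ 2 + beta ^+ 2 <> 0) \/ gamma <> 0,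
      gamma = 0 -> alpha ^+ 2 + beta ^+ 2 <> 0 ->
        coadjoint_orbit F =
          [set F' | exists theta t : R,
             F' = vec4 (alpha * cos theta - beta * sin theta)
                       (alpha * sin theta + beta * cos theta) 0 t] /\
        forall k : int, exists psi : R * R -> 'rV[R]_4,
          let U := [set: R] `*` @Iint R k in
          [/\ local_chart (coadjoint_orbit F) U psi,
              (forall a b c d p q : R, U (p, q) ->
                 let Atilde := pairing (psi (p, q)) (vec4 a b c d) in
                 (Atilde%:C = (d * p)%:C
                    + 2^-1 * (a%:C * (alpha%:C + 'i * beta%:C)
                              + b%:C * (beta%:C - 'i * alpha%:C)) * expi q
                    + 2^-1 * (a%:C * (alpha%:C - 'i * beta%:C)
                              + b%:C * (beta%:C + 'i * alpha%:C))
                      * expi (- q))%C /\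
                 Atilde = d * p + (a * alpha + b * beta) * cos q
                          + (b * alpha - a * beta) * sin q) &
              kirillov_in_chart U psi (fun _ _ => 1)]
    & gamma <> 0 ->
        coadjoint_orbit F =
          [set F' | exists x y t : R,
             F' = vec4 x y gamma t /\
             x ^+ 2 + y ^+ 2 - 2 * gamma * t =
             alpha ^+ 2 + beta ^+ 2 - 2 * gamma * delta] /\
        forall (s : bool) (k : int), exists psi : R * R -> 'rV[R]_4,
          let U := @half_line R s `*` @Iint R k in
          [/\ local_chart (coadjoint_orbit F) U psi,
              (forall a b c d p q : R, U (p, q) ->
                 let Atilde := pairing (psi (p, q)) (vec4 a b c d) in
                 let r := c * gamma + d * delta
                          - d * ((alpha ^+ 2 + beta ^+ 2) / (2 * gamma)) in
                 (Atilde%:C = (d / (2 * gamma) * p ^+ 2)%:C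
                    + (a%:C / 2 * (expi q + expi (- q))
                       + b%:C / (2 * 'i) * (expi q - expi (- q))) * p%:C
                    + r%:C)%C /\
                 Atilde = d / (2 * gamma) * p ^+ 2
                          + (a * cos q + b * sin q) * p + r) &
              kirillov_in_chart U psi (fun p _ => p / gamma)]
  ].
Proof.
split.
- have [g0|g0] := eqVneq gamma 0; last by right; exact/eqP.
  left; split=> // ab0; apply: nontrivF; exists F; rewrite /F g0.
  have a0 : alpha = 0.
    by apply/eqP; rewrite -sqrf_eq0; have := sqr_ge0 beta; have := sqr_ge0 alpha; lra.
  have b0 : beta = 0.
    by apply/eqP; rewrite -sqrf_eq0; have := sqr_ge0 beta; have := sqr_ge0 alpha; lra.
  by rewrite a0 b0 trivial_orbit.
- move=> g0 ab0; rewrite /F g0; split; first exact: cylinder_orbit.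
  move=> k; exists (cylinder_chart alpha beta); split.
  + exact: cylinder_local_chart.
  + move=> a b c d p q _ /=.
    rewrite /cylinder_chart pairing_vec4 /=; split; last by ring.
    rewrite -addrA; transitivity ((d * p)%:C + ((a * alpha + b * beta) * cos q
        + (b * alpha - a * beta) * sin q)%:C)%C.
      by rewrite -rmorphD; congr (_%:C)%C; ring.
    by rewrite -half_expi_sum; field.
  + exact: cylinder_kirillov.
- move=> g0; split; first exact: paraboloid_orbit.
  move=> s k; exists (paraboloid_chart gamma
                       (delta - (alpha ^+ 2 + beta ^+ 2) / (2 * gamma))); split.
  + exact: paraboloid_local_chart.
  + move=> a b c d p q _ /=; move/eqP: g0 => g0.
    rewrite /paraboloid_chart pairing_vec4 /=; split; last by field.
    have i0 : ('i : R[i])%C != 0 by exact: neq0Ci.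
    have i2 : (('i : R[i]) ^+ 2 = -1)%C by rewrite sqr_i.
    have -> : (a%:C / 2 * (expi q + expi (- q)) +
               b%:C / (2 * 'i) * (expi q - expi (- q)) =
               (a * cos q + b * sin q)%:C)%C.
      by rewrite -half_expi_sum; field: i2.
    by rewrite -rmorphM -!rmorphD; congr (_%:C)%C; field.
  + exact: paraboloid_kirillov.
Qed.
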